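(* For all $n,k\geq 0$, the number $b_{n,k}(123)$ of permutations $\pi\in\mathfrak{S}_n(123)$ with $\mathrm{bdes}(\pi)=k$ is $$b_{n,k}(123)=\frac{2}{n+1}\binom{n+1}{k+2}\binom{n-2}{k}.$$
   Context: $\mathfrak{S}_n$ is the set of permutations $\pi=\pi_1\pi_2\cdots\pi_n$ of $[n]=\{1,\dots,n\}$ in one-line notation, with $\mathfrak{S}_0$ consisting only of the empty word. $\mathfrak{S}_n(123)$ is the set of $\pi\in\mathfrak{S}_n$ having no length-three subsequence with the same relative order as $123$. An index $i\in[n-1]$ is a big descent of $\pi\in\mathfrak{S}_n$ if $\pi_i>\pi_{i+1}+1$; $\mathrm{bdes}(\pi)$ is the number of big descents of $\pi$.
   Formalization: The case n = k = 0 is excluded, because there the empty permutation gives b_{0,0}(123) = 1 while the right-hand side is 0, since C(1,2) = 0; C(n-2,k) is read as the generalized binomial coefficient when n < 2. *)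

(* Defs.v *)
From mathcomp Require Import all_boot all_order all_algebra all_fingroup.

Set Implicit Arguments.
Unset Strict Implicit.
Unset Printing Implicit Defensive.

Import GRing.Theory.

(* A permutation of [n] is an element of 'S_n = {perm 'I_n}: positions and
   values are both shifted from {1, ..., n} to {0, ..., n - 1}, which affects
   neither relative orders nor big descents. *)

(* f lists the positions of a subsequence of pi with the same relative order
   as sigma. *)
Definition is_occurrence (m n : nat) (sigma : 'S_m) (pi : 'S_n)
    (f : {ffun 'I_m -> 'I_n}) : bool :=
  [forall a : 'I_m, forall b : 'I_m, (a < b) ==> (f a < f b)] &&
  [forall a : 'I_m, forall b : 'I_m,
     (sigma a < sigma b) == (pi (f a) < pi (f b))].

Definition avoids (m n : nat) (sigma : 'S_m) (pi : 'S_n) : bool :=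
  ~~ [exists f : {ffun 'I_m -> 'I_n}, is_occurrence sigma pi f].

Definition perm123 : 'S_3 := 1%g.

Definition big_descent (n : nat) (pi : 'S_n) (i : 'I_n) : bool :=
  [exists j : 'I_n, (j == i.+1 :> nat) && (pi j + 1 < pi i)].

Definition bdes (n : nat) (pi : 'S_n) : nat :=
  #|[set i : 'I_n | big_descent pi i]|.

(* For n = 0 the only permutation is the empty one, so that
   bdes_count sigma 0 0 = 1 as soon as m > 0. *)
Definition bdes_count (m : nat) (sigma : 'S_m) (n k : nat) : nat :=
  #|[set pi : 'S_n | avoids sigma pi & bdes pi == k]|.

(* Binomial coefficient with an upper index of arbitrary sign: the upper index
   n - 2 is negative for n < 2, and binom(-1, 0) = 1 is needed for n = 1. *)
Definition gbinom (x : int) (k : nat) : rat :=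
  ((\prod_(i < k) (x - i%:Z)%:~R) / (k`!)%:R)%R.

(* Main.v *)
Require Import Defs.
From mathcomp Require Import all_boot all_order all_algebra all_fingroup.
From mathcomp Require Import zify ring.

(* Build a 123-avoiding permutation by prepending first entries, and let y mark
   big descents.  The largest values of the word, down to just above the largest
   bottom of an ascent, form a decreasing queue, and the new entry must be
   inserted in this queue; it creates one big descent if it separates two queue
   entries that were consecutive in the word, and one if it exceeds the old first
   entry by more than one.  As a function of the queue, the generating
   function of the continuations is a polynomial in the difference operator
   Delta of its length, each bit (consecutive or not) contributing a factor
   1 + y Delta or 1 + Delta.  In the basis of iterated differences the prepending
   step becomes a walk on the half-line, which is solved by ballot numbers in the
   Bernstein basis y^m (1 - y)^(r - m): the generating polynomial over
   permutations of [r + 1] is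
     sum_m C(r + m + 1, 2m + 1) Cat_(m+1) y^m (1 - y)^(r - m).
   Its coefficients reduce to iterated differences of binomial coefficients. *)

Set Implicit Arguments.
Unset Strict Implicit.
Unset Printing Implicit Defensive.

Import Order.TTheory GRing.Theory Num.Theory.
Local Open Scope nat_scope.

(** * Words and prepending *)

Fixpoint adjacencies (r : rel nat) (s : seq nat) : nat :=
  if s is x :: s' then (if s' is y :: _ then r x y : nat else 0) + adjacencies r s'
  else 0.

Definition big_descents := adjacencies (fun x y => y.+1 < x).

Definition small_descents_at v := adjacencies (fun x y => (x == v) && (y.+1 == v)).

Definition insert_first (v : nat) (s : seq nat) := v :: map (bump v) s.

Definition decreasing_above (u : nat) (s : seq nat) :=
  pairwise (fun y z => ~~ (u <= y < z)) s.

Fixpoint no123 (s : seq nat) : bool :=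
  if s is x :: s' then decreasing_above x.+1 s' && no123 s' else true.

Lemma ltn_bump v x y : (bump v x < bump v y) = (x < y).
Proof. rewrite /bump; lia. Qed.

Lemma decreasing_above_bump v u s : v <= u ->
  decreasing_above u.+1 (map (bump v) s) = decreasing_above u s.
Proof.
move=> vu; rewrite /decreasing_above pairwise_map; apply: eq_pairwise => x y /=.
by rewrite ltn_bump; congr (~~ (_ && _)); rewrite /bump; lia.
Qed.

Lemma no123_bump v s : no123 (map (bump v) s) = no123 s.
Proof.
elim: s => //= x s ->; congr (_ && _).
rewrite /decreasing_above pairwise_map; apply: eq_pairwise => y z /=.
by rewrite !ltn_bump.
Qed.

Lemma no123_insert_first v s :
  no123 (insert_first v s) = decreasing_above v s && no123 s.
Proof. by rewrite /= no123_bump decreasing_above_bump. Qed.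

(** Bumping widens a descent from [x] to [y], by one, only if [y < v <= x]; it becomes big just when
    [x = v] and [y = v - 1]. *)
Lemma big_descents_bump v s :
  big_descents (map (bump v) s) = big_descents s + small_descents_at v s.
Proof.
rewrite /big_descents /small_descents_at; elim: s => //= x [|y s] //= ->.
by rewrite [RHS]addnACA; congr (_ + _); rewrite /bump; lia.
Qed.

Lemma small_descents_at_bump v w s : v <= w ->
  small_descents_at w.+2 (map (bump v) s) = small_descents_at w.+1 s.
Proof.
move=> vw; rewrite /small_descents_at.
by elim: s => //= x [|y s] //= ->; congr (_ + _); rewrite /bump; lia.
Qed.

(** The value [v] is missing from the bumped word. *)
Lemma small_descents_at_bump_succ v s :
  small_descents_at v.+1 (map (bump v) s) = 0.
Proof.
rewrite /small_descents_at.
by elim: s => //= x [|y s] //= ->; rewrite /bump; lia.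
Qed.

Lemma small_descents_at_gt v s : all (fun x => x < v) s -> small_descents_at v s = 0.
Proof.
rewrite /small_descents_at; elim: s => // x s IH /andP[xv /IH /= ->].
by case: (s) => //= y t; rewrite (ltn_eqF xv).
Qed.

(* [b] records, for the top [size b].+1 values [m], [m.-1], ..., which of them
   are immediately followed by the next smaller value; [f] tells whether the
   first entry lies below these top values. *)
Record state (m : nat) (s : seq nat) (b : seq bool) (f : bool) : Prop := State {
  state_size : size b <= m;
  state_below : all (fun x => x < m.+1) s;
  state_top : m \in s;
  state_decreasing : forall u, decreasing_above u s = (m - size b <= u);
  state_bits : forall i, i <= size b ->
    small_descents_at (m - i) s = nth false b i;
  state_flag : f -> size b < m;
  state_head : s = (if f then (m - size b).-1 else m) :: behead s
}.

Lemma state_init : state 0 [:: 0] [::] false.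
Proof. by split=> // -[|u] //=. Qed.

(** A new maximum extends the queue at its top. The old first entry is [m] unless the flag is set,
    so either the new bit is true or a big descent appears. *)
Lemma state_push m s b f : state m s b f ->
  state m.+1 (insert_first m.+1 s) (~~ f :: b) false /\
  big_descents (insert_first m.+1 s) = f + big_descents s.
Proof.
case=> szb below top dec bits flag hd.
have bump_id : map (bump m.+1) s = s.
  by rewrite map_id_in // => x /(allP below); rewrite /bump; lia.
rewrite /insert_first bump_id; split; last first.
  by rewrite hd /big_descents /=; case: (f) flag => //= flag; lia.
split=> //=.
- by rewrite ltnSn /=; apply: sub_all below => x /=; lia.
- by rewrite mem_head.
- move=> u; rewrite subSS -dec /decreasing_above /=.
  rewrite [all _ s](_ : _ = true) //.
  by apply: sub_all below => x /=; lia.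
- case=> [_|i ib] /=.
    rewrite subn0 /small_descents_at [LHS]/=.
    rewrite -/(small_descents_at m.+1 s) small_descents_at_gt // addn0.
    rewrite hd /= eqxx eqSS; case: (f) flag => //= flag; last by rewrite eqxx.
    by lia.
  rewrite subSS -bits // {1}/small_descents_at [LHS]/=.
  rewrite -/(small_descents_at (m - i) s) hd.
  by rewrite [m.+1 == _](_ : _ = false) //; lia.
Qed.

(** The new entry starts an ascent to the maximum, so only the queue above it survives. If [f]
    holds, the old first entry is not bumped and lies [size b - i + 1] below the new one; otherwise
    the word starts with an ascent. *)
Lemma state_insert m s b f i : state m s b f -> i <= size b ->
  state m.+1 (insert_first (m - i) s) (take i b) true /\
  big_descents (insert_first (m - i) s) =
    (f && (i < size b)) + nth false b i + big_descents s.
Proof.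
case=> szb below top dec bits flag hd ib.
have szt : size (take i b) = i by rewrite size_take_min; lia.
split; last first.
  rewrite /insert_first {1}/big_descents [LHS]/= -/(big_descents (map _ s)).
  rewrite big_descents_bump bits // [big_descents s + _]addnC addnA.
  congr (_ + _ + _).
  by rewrite hd /= /bump; case: (f) flag => /= [/(_ isT)|_]; lia.
have memb : m.+1 \in map (bump (m - i)) s.
  by apply/mapP; exists m => //; rewrite /bump; lia.
split.
- by rewrite szt; lia.
- rewrite /= all_map; apply/andP; split; first by lia.
  by apply: sub_all below => x /=; rewrite /bump; lia.
- by rewrite inE memb orbT.
- move=> u; rewrite szt; have [ui|ui] := ltnP (m - i) u.
    rewrite /insert_first /decreasing_above /= -/(decreasing_above u _).
    rewrite (_ : all _ _ = true); last by apply/allP => z _; lia.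
    by case: u ui => // u ui; rewrite decreasing_above_bump ?dec; lia.
  rewrite [RHS](_ : _ = false); last by lia.
  (* The first entry [m - i] and the later [m.+1] form an ascent. *)
  by apply/negP => /andP[/allP /(_ _ memb)]; lia.
- move=> j; rewrite szt => ji.
  rewrite {1}/small_descents_at [LHS]/= -/(small_descents_at (m.+1 - j) _).
  rewrite [m - i == _](_ : _ = false); last by lia.
  rewrite [(if _ is _ :: _ then _ else _)](_ : _ = 0); last by case: (s).
  rewrite add0n; move: ji; rewrite leq_eqVlt => /orP[/eqP ->|ji].
    by rewrite subSn ?small_descents_at_bump_succ ?nth_default ?szt //; lia.
  rewrite nth_take // -bits; last by lia.
  have -> : m.+1 - j = (m - j).-1.+2 by lia.
  by rewrite small_descents_at_bump; [congr small_descents_at|]; lia.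
- by rewrite szt; lia.
- by rewrite szt /=; congr (_ :: _); lia.
Qed.

(** * Generating functions of extensions *)

Definition word (n : nat) (pi : 'S_n) : seq nat := [seq val (pi i) | i <- enum 'I_n].

Lemma word_lift_perm n (s : 'S_n) (v : 'I_n.+1) :
  word (lift_perm ord0 v s) = insert_first v (word s).
Proof.
rewrite /word enum_ordSl /= lift_perm_id; congr (_ :: _).
by rewrite -!map_comp; apply: eq_map => i /=; rewrite lift_perm_lift.
Qed.

Lemma lift_perm0_bij n :
  bijective (fun p : 'S_n * 'I_n.+1 => lift_perm ord0 p.2 p.1).
Proof.
apply: inj_card_bij => [[s v] [s' v'] /= eq_sv|].
  have eq_v : v = v' by rewrite -(lift_perm_id ord0 v s) eq_sv lift_perm_id.
  subst v'; congr (_, _); apply/permP => i; apply: (@lift_inj _ v).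
  by rewrite -(lift_perm_lift ord0 v s) eq_sv lift_perm_lift.
by rewrite card_prod card_ord !card_Sn factS mulnC.
Qed.

Local Open Scope ring_scope.

Section Extensions.

Variables (R : comNzRingType) (y : R).

Lemma sum_lift_perm (F : seq nat -> R) n :
  \sum_(pi : 'S_n.+1) F (word pi) =
  \sum_(s : 'S_n) \sum_(v < n.+1) F (insert_first v (word s)).
Proof.
rewrite (reindex _ (onW_bij _ (lift_perm0_bij n))) pair_bigA /=.
by apply: eq_bigr => -[s v] _; rewrite word_lift_perm.
Qed.

Fixpoint extension_sum (F : seq nat -> R) (r n : nat) (s : seq nat) : R :=
  if r is r'.+1 then \sum_(v < n.+1) extension_sum F r' n.+1 (insert_first v s)
  else F s.

Lemma extension_sumS F r n s :
  extension_sum F r.+1 n s =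
  \sum_(v < n.+1) extension_sum F r n.+1 (insert_first v s).
Proof. by []. Qed.

Lemma extension_sumSr F r n s :
  extension_sum F r.+1 n s =
  extension_sum (fun t => \sum_(v < (r + n).+1) F (insert_first v t)) r n s.
Proof.
elim: r n s => [|r IH] n s //=.
by apply: eq_bigr => v _; rewrite addSnnS -IH.
Qed.

Lemma sum_extension F r n :
  \sum_(pi : 'S_(r + n)) F (word pi) = \sum_(s : 'S_n) extension_sum F r n (word s).
Proof.
elim: r F => // r IH F; rewrite sum_lift_perm.
rewrite [LHS](IH (fun t => \sum_(v < (r + n).+1) F (insert_first v t))).
by apply: eq_bigr => s _; rewrite extension_sumSr.
Qed.

Definition weight (s : seq nat) : R := if no123 s then y ^+ big_descents s else 0.

Lemma extension_weight0 r n s : ~~ no123 s -> extension_sum weight r n s = 0.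
Proof.
elim: r n s => [|r IH] n s av /=; first by rewrite /weight (negPf av).
rewrite big1 // => v _; rewrite IH //; apply: contra av.
by rewrite no123_insert_first => /andP[].
Qed.

(** Generating function of [r] further prependings. The last term is the insertion just below the
    whole queue, which creates no big descent even when the flag is set. *)
Fixpoint state_sum (r : nat) (b : seq bool) (f : bool) : R :=
  if r is r'.+1 then
    y ^+ f * state_sum r' (~~ f :: b) false
    + \sum_(i < size b) y ^+ (f + nth false b i) * state_sum r' (take i b) true
    + state_sum r' b true
  else 1.

Lemma state_sumS r b f :
  state_sum r.+1 b f =
  y ^+ f * state_sum r (~~ f :: b) false
  + \sum_(i < size b) y ^+ (f + nth false b i) * state_sum r (take i b) true
  + state_sum r b true.
Proof. by []. Qed.

Lemma extension_weight r m s b f : state m s b f -> no123 s ->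
  extension_sum weight r m.+1 s = y ^+ big_descents s * state_sum r b f.
Proof.
elim: r m s b f => [|r IH] m s b f st av; first by rewrite /= /weight av mulr1.
have szb := state_size st.
have dec := state_decreasing st.
(* Values are read from the top: index [0] is the new maximum, index [i.+1] the value [m - i]. *)
rewrite extension_sumS state_sumS (reindex_inj rev_ord_inj) big_ord_recl.
rewrite !mulrDr /= subn1 -addrA.
congr (_ + _).
  have [st' bd] := state_push st.
  rewrite (IH _ _ _ _ st') ?no123_insert_first ?av ?dec ?andbT; last by lia.
  by rewrite bd exprD mulrCA mulrA.
rewrite (bigID (fun i : 'I_m.+1 => (i < (size b).+1)%N)) /=.
rewrite [X in _ + X]big1 => [|i ib]; last first.
  rewrite extension_weight0 // no123_insert_first dec av andbT /bump.
  by move: (ltn_ord i); lia.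
rewrite addr0 -(big_ord_widen _ (fun i => extension_sum weight r m.+2
  (insert_first (m.+2 - (bump 0 i).+1) s))) // big_ord_recr /= mulr_sumr.
have step i : (i <= size b)%N ->
    extension_sum weight r m.+2 (insert_first (m.+2 - (bump 0 i).+1) s) =
    y ^+ ((f && (i < size b)%N) + nth false b i + big_descents s) *
      state_sum r (take i b) true.
  move=> ib; have -> : (m.+2 - (bump 0 i).+1 = m - i)%N by rewrite /bump; lia.
  have [st' bd] := state_insert st ib.
  by rewrite (IH _ _ _ _ st') ?bd // no123_insert_first av dec andbT; lia.
rewrite step // ltnn andbF nth_default // take_size; congr (_ + _).
apply: eq_bigr => i _; rewrite step; last by apply: ltnW.
by rewrite ltn_ord andbT [(_ + _ + big_descents s)%N]addnC exprD mulrA.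
Qed.

(* Expanding in the basis of iterated differences, the value at a state with
   queue [b] of a function of the size of the queue; a bit [1] acts on it as
   [1 + y Delta] and a bit [0] as the shift [1 + Delta]. *)
Fixpoint queue_eval (b : seq bool) (u : nat -> R) : R :=
  if b is c :: b' then queue_eval b' (fun j => u j + y ^+ c * u j.+1) else u 0%N.

Lemma eq_queue_eval b u v : u =1 v -> queue_eval b u = queue_eval b v.
Proof.
elim: b u v => /= [|c b IH] u v uv; first exact: uv.
by apply: IH => j; rewrite !uv.
Qed.

Lemma queue_evalD b u v :
  queue_eval b (fun j => u j + v j) = queue_eval b u + queue_eval b v.
Proof.
elim: b u v => //= c b IH u v; rewrite -IH.
by apply: eq_queue_eval => j; ring.
Qed.

Lemma queue_evalZ b a u : queue_eval b (fun j => a * u j) = a * queue_eval b u.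
Proof.
elim: b u => //= c b IH u; rewrite -IH.
by apply: eq_queue_eval => j; ring.
Qed.

Lemma queue_eval_delta b a : queue_eval b (fun j => a *+ (j == 0%N)) = a.
Proof.
elim: b => //= c b IH; rewrite -[RHS]IH.
by apply: eq_queue_eval => j; rewrite mulr0n mulr0 addr0.
Qed.

Definition shift_right (u : nat -> R) (j : nat) : R := if j is j'.+1 then u j' else 0.

(* Summation by parts: [shift_right u j + u j] are the iterated differences of the
   partial sums of a function with iterated differences [u]. *)
Lemma queue_eval_sum b u :
  \sum_(i < size b) y ^+ nth false b i * queue_eval (take i b) u + queue_eval b u =
  queue_eval b (fun j => u j + shift_right u j).
Proof.
elim: b u => [|c b IH] u; first by rewrite big_ord0 /= add0r addr0.
rewrite big_ord_recl /= -addrA IH -[y ^+ c * u 0%N](queue_eval_delta b) -queue_evalD.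
by apply: eq_queue_eval => -[|j] /=; rewrite ?mulr1n ?mulr0n; ring.
Qed.

(** [g] and [h] are the iterated differences with the flag set and unset. A push adds a bit, hence
    acts on [h]; the insertions form a partial sum of [g] over truncated queues, handled by
    [queue_eval_sum]. *)
Lemma state_sum_queue (g h : nat -> nat -> R) r b f :
  g 0%N =1 (fun j => (j == 0%N)%:R) -> h 0%N =1 (fun j => (j == 0%N)%:R) ->
  (forall r j, h r.+1 j = h r j + y * h r j.+1 + (g r j + shift_right (g r) j)) ->
  (forall r j, g r.+1 j = y * (h r j + h r j.+1) + g r j + y * shift_right (g r) j) ->
  state_sum r b f = queue_eval b (if f then g r else h r).
Proof.
move=> g0 h0 hS gS; elim: r b f => [|r IH] b f.
  rewrite /= -[LHS](queue_eval_delta b).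
  by apply: eq_queue_eval => j; case: (f); rewrite ?g0 ?h0.
have sumE : \sum_(i < size b) y ^+ (f + nth false b i) * state_sum r (take i b) true
    = y ^+ f * (queue_eval b (fun j => g r j + shift_right (g r) j) - queue_eval b (g r)).
  rewrite -queue_eval_sum addrK mulr_sumr; apply: eq_bigr => i _.
  by rewrite IH exprD mulrA.
rewrite state_sumS sumE !IH /=; case: f {sumE} => /=.
  rewrite expr1 expr0 -[X in X + _]mulrDr -mulN1r -!queue_evalZ -!queue_evalD.
  rewrite -queue_evalZ -queue_evalD.
  by apply: eq_queue_eval => j; rewrite gS; ring.
rewrite expr0 expr1 !mul1r addrA subrK -queue_evalD.
by apply: eq_queue_eval => j; rewrite hS.
Qed.

End Extensions.

(** * Closed form *)

Local Open Scope nat_scope.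

(* Walks from 0 with step generating function [z^-1 + 2 + z], killed below 0;
   [ballot m 0] is the Catalan number of index [m.+1]. *)
Fixpoint ballot (m j : nat) : nat :=
  if m is m'.+1 then
    2 * ballot m' j + ballot m' j.+1 + (if j is j'.+1 then ballot m' j' else 0)
  else j == 0.

(** The step factors as [(1 + z)(1 + z^-1)]; this is the walk after the extra half step [1 + z], and
    [ballot2S] is the other half. *)
Definition ballot2 (m j : nat) : nat :=
  ballot m j + (if j is j'.+1 then ballot m j' else 0).

Lemma ballot2S m j : ballot2 m j + ballot2 m j.+1 = ballot m.+1 j.
Proof. by rewrite /ballot2; case: j => [|j] /=; lia. Qed.

Lemma binSS n k : 'C(n.+2, k.+2) = 'C(n, k.+2) + 2 * 'C(n, k.+1) + 'C(n, k).
Proof. by rewrite !binS; lia. Qed.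

(** Reflection at [-1]: the endpoint [j] is mirrored to [- j - 2]. The induction checks the
    recurrence. *)
Lemma ballot_bin m j : ballot m j + 'C(m.*2, m + j.+2) = 'C(m.*2, m + j).
Proof.
elim: m j => [|m IH] j; first by rewrite /= bin0n bin0n addn0.
rewrite doubleS !addSn !addnS.
case: j => [|j].
  rewrite addn0; case: m IH => [|m] IH; first by [].
  (* The killing condition: the difference of binomials vanishes at [j = -1]. *)
  have sym : 'C(m.+1.*2, m) = 'C(m.+1.*2, m.+2).
    by rewrite -bin_sub; [congr 'C(_, _)|]; lia.
  have -> : ballot m.+2 0 = 2 * ballot m.+1 0 + ballot m.+1 1 by exact: addn0.
  have := IH 1; have := IH 0; move: sym; rewrite !addnS addn0.
  by move: m.+1.*2 => N; rewrite !binSS; lia.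
have := IH j; have := IH j.+1; have := IH j.+2; rewrite !addnS !binSS.
have -> : ballot m.+1 j.+1 = 2 * ballot m j.+1 + ballot m j.+2 + ballot m j by [].
lia.
Qed.

Lemma ballot0 m : m.+2 * ballot m 0 = 'C(m.+1.*2, m.+1).
Proof.
have := ballot_bin m 0; rewrite addn0 addn2.
have := mul_bin_left m.*2 m; have := mul_bin_left m.*2 m.+1.
have := mul_bin_diag m.*2.+2 m; rewrite [m.*2.+2.-1]/=.
have := mul_bin_down m.*2.+1 m; rewrite [m.*2.+1.-1]/=.
have -> : m.+1.*2 = m.*2.+2 by lia.
have -> : m.*2 - m = m by lia.
have -> : m.*2.+1 - m = m.+1 by lia.
(* Everything is reduced to the central coefficient, named [c0]. *)
move: 'C(m.*2, m) 'C(m.*2, m.+1) 'C(m.*2, m.+2) 'C(m.*2.+1, m) 'C(m.*2.+2, m.+1).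
move: (ballot m 0) => b c0 c1 c2 d e.
have -> : m.*2 - m.+1 = m.-1 by lia.
move=> ed dc c21 c10 bc.
have e2 : m.+1 * (m.-1 * c1) = m.-1 * m * c0 by rewrite mulnCA c10; lia.
have e3 : m.+1 * m.+2 * c2 = m.-1 * m * c0 by rewrite -e2 -c21 mulnA.
have e4 : m.+1 * e = 2 * m.*2.+1 * c0 by nia.
apply/eqP; rewrite -(eqn_pmul2l (ltn0Sn m)) e4 mulnA; apply/eqP.
have e5 : m.+1 * m.+2 * (b + c2) = m.+1 * m.+2 * c0 by rewrite bc.
by case: m {bc ed dc c21 c10 e2 e4} e3 e5 => [|m] /= e3 e5; nia.
Qed.

Local Open Scope ring_scope.

Section ClosedForm.

Variables (R : comNzRingType) (y : R).

Definition bernstein_sum (r : nat) (c : nat -> nat) : R :=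
  \sum_(m < r.+1) (1 - y) ^+ (r - m) * y ^+ m * (c m)%:R.

Lemma eq_bernstein_sum r c d :
  (forall m, (m <= r)%N -> c m = d m) -> bernstein_sum r c = bernstein_sum r d.
Proof. by move=> cd; apply: eq_bigr => m _; rewrite cd // -ltnS. Qed.

Lemma bernstein_sumD r c d :
  bernstein_sum r (fun m => c m + d m)%N = bernstein_sum r c + bernstein_sum r d.
Proof. by rewrite -big_split; apply: eq_bigr => m _; rewrite natrD mulrDr. Qed.

Lemma bernstein_sum_mul1y r c : c r.+1 = 0%N ->
  (1 - y) * bernstein_sum r c = bernstein_sum r.+1 c.
Proof.
move=> c0; rewrite [RHS]big_ord_recr /= c0 mulr0 addr0 mulr_sumr.
by apply: eq_bigr => m _; rewrite subSn 1?exprS ?mulrA // -ltnS.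
Qed.

Lemma bernstein_sum_muly r c :
  y * bernstein_sum r c =
  bernstein_sum r.+1 (fun m => if m is m'.+1 then c m' else 0%N).
Proof.
rewrite [RHS]big_ord_recl /= mulr0 add0r mulr_sumr.
by apply: eq_bigr => m _; rewrite /bump /= subSS exprS; ring.
Qed.

(* The iterated differences of [state_sum r] are [below_coef r] when the first
   entry lies below the queue, and [below_coef r + gap_coef r] when it is the
   maximum. *)
Definition below_coef r j :=
  bernstein_sum r (fun m => 'C(r + m, m.*2) * ballot m j)%N.

Definition gap_coef r j :=
  bernstein_sum r (fun m => 'C(r + m, m.*2.+1) * ballot2 m j)%N.

(** This is the difference of the two recurrences in [state_sum_queue], where a factor [1 - y] comes
    out. It holds by Pascal's rule and the half step [1 + z]. *)
Lemma gap_coefS r j :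
  gap_coef r.+1 j =
  (1 - y) * (gap_coef r j + below_coef r j + shift_right (below_coef r) j).
Proof.
have -> : shift_right (below_coef r) j = bernstein_sum r
    (fun m => 'C(r + m, m.*2) * (if j is j'.+1 then ballot m j' else 0))%N.
  case: j => //=; rewrite /bernstein_sum big1 // => m _.
  by rewrite muln0 mulr0.
rewrite -!bernstein_sumD bernstein_sum_mul1y; last by rewrite !bin_small //; lia.
apply: eq_bernstein_sum => m _; rewrite addSn binS mulnDl.
by rewrite {2}/ballot2 mulnDr addnA.
Qed.

(** Two Pascal steps split the coefficient of index [m.+1]: a full walk step accounts for
    [C(r + m, 2m)], the half step [1 + z^-1] on [gap_coef] for one [C(r + m, 2m + 1)], and the
    factor [1 - y] for the rest. *)
Lemma below_coefS r j :
  below_coef r.+1 j =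
  (1 - y) * below_coef r j
  + y * (2%:R * below_coef r j + below_coef r j.+1 + shift_right (below_coef r) j
         + gap_coef r j + gap_coef r j.+1).
Proof.
have -> : shift_right (below_coef r) j = bernstein_sum r
    (fun m => 'C(r + m, m.*2) * (if j is j'.+1 then ballot m j' else 0))%N.
  case: j => //=; rewrite /bernstein_sum big1 // => m _.
  by rewrite muln0 mulr0.
rewrite mulr_natl mulr2n -!bernstein_sumD bernstein_sum_muly bernstein_sum_mul1y;
  last by rewrite !bin_small //; lia.
rewrite -bernstein_sumD; apply: eq_bernstein_sum => -[|m] _.
  by rewrite !double0 !bin0 addn0.
rewrite doubleS addSn addnS binSS -addnA -ballot2S.
have := ballot2S m j; rewrite /= => e; rewrite e.
have := congr1 (muln 'C(r + m, m.*2.+1)) e; rewrite mulnDr binS => e'; nia.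
Qed.

Lemma state_sum_init r :
  state_sum y r [::] false =
  bernstein_sum r (fun m => 'C((r + m).+1, m.*2.+1) * ballot m 0)%N.
Proof.
rewrite (@state_sum_queue R y below_coef (fun r j => below_coef r j + gap_coef r j)).
- rewrite /= -bernstein_sumD; apply: eq_bernstein_sum => m _.
  by rewrite binS mulnDl /ballot2 addn0 addnC.
- move=> j; rewrite /below_coef /bernstein_sum big_ord1 /=.
  by rewrite !expr0 !mul1r mul1n.
- move=> j; rewrite /below_coef /gap_coef /bernstein_sum !big_ord1 /=.
  by rewrite !expr0 !mul1r mul1n mul0n addr0.
- by move=> {}r j; rewrite gap_coefS below_coefS; ring.
- by move=> {}r j; rewrite below_coefS; ring.
Qed.

End ClosedForm.

(** * Extraction of coefficients *)

Local Open Scope nat_scope.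

Lemma size_word n (pi : 'S_n) : size (word pi) = n.
Proof. by rewrite size_map size_enum_ord. Qed.

Lemma nth_word n (pi : 'S_n) (i : 'I_n) : nth 0 (word pi) i = pi i.
Proof. by rewrite (nth_map i) ?size_enum_ord // nth_ord_enum. Qed.

Lemma decreasing_aboveP u s :
  reflect (forall i j, i < j < size s -> ~~ (u <= nth 0 s i < nth 0 s j))
    (decreasing_above u s).
Proof.
apply: (iffP (pairwiseP 0)) => dec i j.
  by case/andP=> ij js; apply: dec => //; apply: ltn_trans js.
by rewrite !inE => _ js ij; apply: dec; rewrite ij.
Qed.

Lemma no123P s :
  reflect (forall i j k, i < j < k -> k < size s ->
             ~~ (nth 0 s i < nth 0 s j < nth 0 s k))
    (no123 s).
Proof.
elim: s => [|x s IH] /=; first by constructor=> i j k; lia.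
apply: (iffP andP) => [[/decreasing_aboveP dec /IH av] i j k ijk ks|av].
  case: i j k ijk ks => [|i] [|j] [|k] //; rewrite ?andbF // => ijk ks.
    by apply: dec; move: ijk; rewrite /= ltnS => ->.
  exact: av.
split; first by apply/decreasing_aboveP => i j /andP[ij js]; apply: (av 0 i.+1 j.+1).
by apply/IH => i j k ijk ks; apply: (av i.+1 j.+1 k.+1).
Qed.

Lemma avoids123E n (pi : 'S_n) : avoids perm123 pi = no123 (word pi).
Proof.
apply/idP/no123P => [av i j k ijk|av]; last first.
  apply/existsP => -[f /andP[/forallP incr /forallP same]].
  pose a := Ordinal (isT : 0 < 3); pose b := Ordinal (isT : 1 < 3).
  pose c := Ordinal (isT : 2 < 3).
  have fab := implyP (forallP (incr a) b) isT.
  have fbc := implyP (forallP (incr b) c) isT.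
  have pab := forallP (same a) b; have pbc := forallP (same b) c.
  move: (av (f a) (f b) (f c)); rewrite size_word fab fbc => /(_ isT (ltn_ord _)).
  by rewrite !nth_word -(eqP pab) -(eqP pbc) !perm1.
rewrite size_word => kn; case/andP: ijk => ij jk.
apply: contra av => /andP[pij pjk]; apply/existsP.
pose k' := Ordinal kn; pose j' := Ordinal (ltn_trans jk kn).
pose i' := Ordinal (ltn_trans ij (ltn_trans jk kn)).
(* Index [2] falls on the default [k']. *)
exists [ffun a : 'I_3 => nth k' [:: i'; j'] a].
rewrite (nth_word pi i') (nth_word pi j') (nth_word pi k') in pij pjk.
have pik := ltn_trans pij pjk.
by apply/andP; split; apply/forallP => -[[|[|[|a]]] Ha] //;
  apply/forallP => -[[|[|[|b]]] Hb] //; rewrite !ffunE ?perm1 /= //;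
  rewrite ?ltnn ?pij ?pjk ?pik ?(ltn_trans ij jk) //; apply/eqP/esym; lia.
Qed.

Lemma adjacenciesE r s :
  adjacencies r s =
  \sum_(i < size s) ((i.+1 < size s) && r (nth 0 s i) (nth 0 s i.+1)).
Proof.
elim: s => [|x s IH] /=; first by rewrite big_ord0.
by rewrite big_ord_recl /= IH; case: s {IH}.
Qed.

Lemma bdesE n (pi : 'S_n) : bdes pi = big_descents (word pi).
Proof.
rewrite /bdes /big_descents adjacenciesE size_word -sum1_card big_mkcond.
apply: eq_bigr => i _; rewrite inE nth_word; congr (nat_of_bool _).
apply/existsP/andP => [[j /andP[/eqP ji bd]]|[lt_in bd]].
  by rewrite -ji ltn_ord nth_word -addn1.
by exists (Ordinal lt_in); rewrite eqxx addn1 -nth_word.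
Qed.

Local Open Scope ring_scope.

Lemma bdes_count_coef n k :
  (bdes_count perm123 n k)%:R =
  (\sum_(pi : 'S_n) weight 'X (word pi))`_k :> rat.
Proof.
rewrite coef_sum /bdes_count -sum1_card natr_sum big_mkcond.
apply: eq_bigr => pi _; rewrite inE avoids123E bdesE /weight.
by case: no123; rewrite ?coef0 // coefXn eq_sym; case: eqP.
Qed.

Lemma sum_weight (R : comNzRingType) (y : R) r :
  \sum_(pi : 'S_r.+1) weight y (word pi) =
  bernstein_sum y r (fun m => 'C((r + m).+1, m.*2.+1) * ballot m 0)%N.
Proof.
rewrite -state_sum_init; have := sum_extension (weight y) r 1; rewrite addn1 => ->.
rewrite (big_pred1 1%g) => [|s]; last first.
  by apply/esym/eqP/permP => i; rewrite [LHS]ord1 [RHS]ord1.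
have -> : word (1%g : 'S_1) = [:: 0%N].
  apply: (@eq_from_nth _ 0%N); rewrite size_word // => -[|i] // _.
  by rewrite (nth_word _ ord0) perm1.
by rewrite (extension_weight y r state_init) // expr0 mul1r.
Qed.

(** * Binomial identities *)

Lemma coef_1subXn (R : comNzRingType) p i :
  ((1 - 'X) ^+ p : {poly R})`_i = (-1) ^+ i * 'C(p, i)%:R.
Proof.
elim: p i => [|p IH] i.
  by rewrite expr0 coef1 bin0n; case: i => [|i]; rewrite ?mulr1 ?mulr0.
rewrite exprS mulrBl mul1r coefB coefXM !IH.
case: i => [|i] /=; first by rewrite !bin0 subr0.
by rewrite binS natrD exprS; ring.
Qed.

(** For [c <= N], [C(N + m, m + c) = C(N + m, N - c)], and each difference in the upper index lowers
    [N - c] by one. *)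
Lemma alternating_bin_sum (R : comNzRingType) N c k :
  \sum_(m < k.+1) (-1) ^+ (k - m) * ('C(k, m) * 'C(N + m, m + c))%:R =
  'C(N, k + c)%:R :> R.
Proof.
elim: k N c => [|k IH] N c.
  by rewrite big_ord1 /= mul1r bin0 mul1n addn0.
rewrite addSn.
have -> : 'C(N, (k + c).+1)%:R = 'C(N.+1, k + c.+1)%:R - 'C(N, k + c)%:R :> R.
  by rewrite addnS binS natrD addrK.
rewrite -!IH -sumrN.
transitivity (\sum_(m < k.+1) (-1) ^+ (k - m) * ('C(k, m) * 'C(N.+1 + m, m + c.+1))%:R
  + \sum_(m < k.+2) (-1) ^+ (k.+1 - m) * ('C(k, m) * 'C(N + m, m + c))%:R : R).
  rewrite big_ord_recl [X in _ = _ + X]big_ord_recl !bin0 addrCA -big_split.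
  congr (_ + _); apply: eq_bigr => m _.
  rewrite /= /bump leq0n add1n subSS addSnnS binS -mulrDr -natrD.
  by rewrite (addSnnS N m) -mulnDl [('C(k, m) + _)%N]addnC.
rewrite [X in _ + X]big_ord_recr /= bin_small // mul0n mulr0 addr0.
congr (_ + _); apply: eq_bigr => m _.
by rewrite subSn -1?ltnS // exprS mulN1r mulNr.
Qed.

Lemma gbinomE (p k : nat) : gbinom p%:Z k = 'C(p, k)%:R.
Proof.
rewrite /gbinom; suff -> : \prod_(i < k) (p%:Z - i%:Z)%:~R = (p ^_ k)%:R :> rat.
  by rewrite -bin_ffact natrM mulfK // pnatr_eq0 -lt0n fact_gt0.
elim: k => [|k IH]; first by rewrite big_ord0.
rewrite big_ord_recr /= IH ffactnSr natrM; have [kp|pk] := leqP k p.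
  by rewrite subzn.
by rewrite ffact_small // !mul0r.
Qed.

Lemma natr_bin (R : numFieldType) a b :
  'C(a + b, a)%:R = (a + b)`!%:R / (a`!%:R * b`!%:R) :> R.
Proof.
have -> : (a + b)`! = ('C(a + b, a) * (a`! * b`!))%N.
  by rewrite -(bin_fact (leq_addr b a)) addKn.
by rewrite !natrM mulfK // -natrM pnatr_eq0 -lt0n muln_gt0 !fact_gt0.
Qed.

(** With [m + e = k], the first factor on the right depends only on [r] and [k]; the second is a
    term of [alternating_bin_sum] with [N = r.+2], [c = 2]. *)
Lemma bernstein_coef_term (r m e d : nat) : r.+1 = (m + e + d)%N ->
  ('C((r.+1 + m).+1, m.*2.+1) * ballot m 0 * 'C(e + d, e))%:R =
  2%:R * r`!%:R / ((m + e)`!%:R * d`!%:R)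
    * ('C(m + e, m) * 'C(r.+2 + m, m + 2))%:R :> rat.
Proof.
move=> er.
have -> : ((r.+1 + m).+1 = m.*2.+1 + (e + d))%N by lia.
have -> : (r.+2 + m = (m + 2) + r)%N by lia.
have b0 : (ballot m 0)%:R = 'C(m.+1 + m.+1, m.+1)%:R / m.+2%:R :> rat.
  by rewrite addnn -ballot0 natrM mulrC mulKf // pnatr_eq0.
rewrite !natrM b0 !natr_bin.
have -> : (m.*2.+1 + (e + d) = m + 2 + r)%N by lia.
have -> : (m.+1 + m.+1 = m.*2.+2)%N by lia.
have factSr i : (i.+1)`!%:R = i.+1%:R * i`!%:R :> rat by rewrite factS natrM.
rewrite addn2 (factSr m.*2.+1) (factSr m.+1) (factSr m).
have -> : m.*2.+2%:R = 2%:R * m.+1%:R :> rat by rewrite -natrM; congr _%:R; lia.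
have [F F0 FE] : exists2 F : nat -> rat, forall n, F n != 0 & forall n, n`!%:R = F n.
  by exists (fun n => n`!%:R) => // n; rewrite pnatr_eq0 -lt0n fact_gt0.
have [x1 x10 ->] : exists2 x : rat, x != 0 & m.+1%:R = x.
  by exists m.+1%:R; rewrite ?pnatr_eq0.
have [x2 x20 ->] : exists2 x : rat, x != 0 & m.+2%:R = x.
  by exists m.+2%:R; rewrite ?pnatr_eq0.
by rewrite !FE; field; rewrite !F0 x10 x20.
Qed.

Theorem theorem2p13 (n k : nat) (hnk : (n, k) <> (0%N, 0%N)) :
  (bdes_count perm123 n k)%:R =
    2%:R / (n.+1)%:R * ('C(n.+1, k.+2))%:R * gbinom (n%:Z - 2%:Z) k :> rat.
Proof.
case: n hnk => [|n] hnk.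
  have k0 : (0 < k)%N by case: k hnk.
  rewrite bin_small ?ltnS // mulr0 mul0r; apply/eqP.
  rewrite pnatr_eq0 cards_eq0; apply/eqP/setP => pi; rewrite !inE bdesE.
  by rewrite [word pi](size0nil (size_word pi)) andbC; case: k k0 {hnk}.
rewrite bdes_count_coef sum_weight coef_sum.
(* Now [n] is the size minus one, and the polynomial has degree at most [n]. *)
have [nk|kn] := ltnP n k.
  rewrite [in RHS]bin_small ?ltnS // mulr0 mul0r big1 // => m _.
  rewrite mulr_natr coefMn coefMXn; case: ifP => // km; first by rewrite mul0rn.
  rewrite coef_1subXn bin_small ?mulr0 ?mul0rn //; move: (ltn_ord m); lia.
transitivity (\sum_(m < k.+1) (-1) ^+ (k - m) *
    ('C((n + m).+1, m.*2.+1) * ballot m 0 * 'C(n - m, k - m))%:R : rat).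
  rewrite (big_ord_widen n.+1 (fun m => (-1) ^+ (k - m) *
    ('C((n + m).+1, m.*2.+1) * ballot m 0 * 'C(n - m, k - m))%:R)) //.
  rewrite [RHS]big_mkcond; apply: eq_bigr => m _.
  rewrite mulr_natr coefMn coefMXn coef_1subXn ltnS.
  case: ltnP => _; first by rewrite mul0rn.
  by rewrite -[LHS]mulr_natr [in RHS]natrM mulrA mulrAC.
(* In size one the upper index is [-1] and [k = 0], so [gbinom] is an empty product. *)
case: n hnk kn => [|r] hnk kn.
  have -> : k = 0%N by lia.
  rewrite big_ord1 /gbinom big_ord0 /=.
  by [].
rewrite (eq_bigr (fun m : 'I_k.+1 => 2%:R * r`!%:R / (k`!%:R * (r.+1 - k)`!%:R) *
   ((-1) ^+ (k - m) * ('C(k, m) * 'C(r.+2 + m, m + 2))%:R))) => [|m _]; last first.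
  have mk : (m <= k)%N by rewrite -ltnS.
  have e1 : r.+1 = (m + (k - m) + (r.+1 - k))%N by lia.
  have e2 : (r.+1 - m)%N = (k - m + (r.+1 - k))%N by lia.
  by rewrite e2 (bernstein_coef_term e1) subnKC // mulrCA.
rewrite -mulr_sumr alternating_bin_sum addn2.
have -> : r.+2%:Z - 2%:Z = r%:Z by lia.
(* If [k = r.+1], both [C(r, k)] and [C(r + 2, k + 2)] vanish. *)
rewrite gbinomE; have [rk|kr] := ltnP r k.
  by rewrite (bin_small rk) bin_small ?mulr0 //; lia.
(* The factor [r.+1 - k] turns [r! / (k! (r + 1 - k)!)] into [C(r, k)]. *)
have -> : 'C(r.+2, k.+2)%:R = (r.+1 - k)%:R * 'C(r.+3, k.+2)%:R / r.+3%:R :> rat.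
  by rewrite -natrM -[(r.+1 - k)%N]/(r.+3 - k.+2)%N -mul_bin_down natrM mulrC mulKf
    // pnatr_eq0.
rewrite -(bin_fact kr) subSn // factS !natrM; field.
by rewrite nat1r -natrD !pnatr_eq0 -!lt0n !fact_gt0.
Qed.
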